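(* Let $X$ be a uniformly perfect metric space with more than one point and let $F\subseteq X$ be non-empty and totally bounded. If $0<\overline{\dim}_{\mathrm B}F\le\dim_{\mathrm A}F<\infty$ then $\overline{\dim}_\theta F>0$ for all $\theta\in(0,1]$. The same holds with $\overline{\dim}$ replaced by $\underline{\dim}$ throughout.
   Context: For a subset $U$ of a metric space, $|U|$ denotes its diameter, and $B(x,r)$ is the open ball. Convention: $\inf\varnothing=\infty$. A metric space $X$ is uniformly perfect if there is $c\in(0,1)$ such that $B(x,R)\setminus B(x,cR)\neq\varnothing$ for all $x\in X$ and $0<R<|X|$. $N_\delta(F)$ is the smallest number of open balls of radius $\delta/2$ with centres in $F$ needed to cover $F$; $F$ is totally bounded if $N_\delta(F)<\infty$ for all $\delta>0$. Box dimensions: $\overline{\dim}_{\mathrm B}F$ and $\underline{\dim}_{\mathrm B}F$ are the $\limsup$ and $\liminf$ as $\delta\to0^+$ of $\log N_\delta(F)/(-\log\delta)$. Intermediate dimensions: for $\theta\in(0,1)$, the upper $\theta$-intermediate dimension $\overline{\dim}_\theta F$ is the infimum of all $s\ge0$ such that for all $\epsilon>0$ there exists $\delta_0\in(0,1]$ such that for all $\delta\in(0,\delta_0)$ there is a finite or countable cover $\{U_1,U_2,\dots\}$ of $F$ by subsets of $X$ with $\delta^{1/\theta}\le|U_i|\le\delta$ for all $i$ and $\sum_i|U_i|^s\le\epsilon$. The lower $\theta$-intermediate dimension $\underline{\dim}_\theta F$ is the infimum of all $s\ge0$ such that for all $\epsilon>0$ and $\delta_0\in(0,1]$ there exist $\delta\in(0,\delta_0)$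 and such a cover with $\delta^{1/\theta}\le|U_i|\le\delta$ for all $i$ and $\sum_i|U_i|^s\le\epsilon$. For $\theta=1$, $\overline{\dim}_1F:=\overline{\dim}_{\mathrm B}F$ and $\underline{\dim}_1F:=\underline{\dim}_{\mathrm B}F$. The Assouad dimension $\dim_{\mathrm A}F$ is the infimum of all $a$ for which there exists $C>0$ such that $N_r(B(x,R)\cap F)\le C(R/r)^a$ for all $x\in F$ and $0<r<R$. *)

(* Defs.v *)
From HB Require Import structures.
From mathcomp Require Import all_boot all_order all_algebra.
From mathcomp Require Import all_classical all_reals all_analysis.

Set Implicit Arguments.
Unset Strict Implicit.
Unset Printing Implicit Defensive.

Import Order.TTheory GRing.Theory Num.Theory.
Import numFieldNormedType.Exports.

Local Open Scope classical_set_scope.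
Local Open Scope ring_scope.
Local Open Scope ereal_scope.

Section Dimensions.
Context {R : realType} {X : metricType R}.
Implicit Types (U F : set X) (r s d eps theta : R).

(* The maximum with 0 only serves to make the diameter of set0 equal to 0. *)
Definition diam U : \bar R :=
  maxe 0 (ereal_sup [set (mdist x y)%:E | x in U & y in U]).

(* N_d(F); it is +oo when no finite cover exists. *)
Definition covnum d F : \bar R :=
  ereal_inf [set (size s)%:R%:E | s in [set s : seq X |
    [set` s] `<=` F /\ F `<=` \bigcup_(c in [set` s]) ball c (d / 2)%R]].

Definition totally_bounded F : Prop :=
  forall d, (0 < d)%R -> covnum d F < +oo.

Definition box_ratio F d : \bar R :=
  lne (covnum d F) * ((- ln d)^-1)%:E.

Definition upper_box_dim F : \bar R := limf_esup (box_ratio F) (0%R : R)^'+.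

Definition lower_box_dim F : \bar R := limf_einf (box_ratio F) (0%R : R)^'+.

(* The index set D : set nat may be finite or infinite. *)
Definition good_cover theta s F eps d : Prop :=
  exists (D : set nat) (U : nat -> set X),
    [/\ F `<=` \bigcup_(i in D) U i,
        forall i, D i -> (d `^ (theta^-1))%:E <= diam (U i) <= d%:E
      & \esum_(i in D) (diam (U i)) `^ s <= eps%:E].

Definition upper_interm_dim theta F : \bar R :=
  if theta == 1%R then upper_box_dim F else
  ereal_inf [set s%:E | s in [set s : R | (0 <= s)%R /\
    forall eps, (0 < eps)%R -> exists2 d0 : R, (0 < d0 <= 1)%R &
      forall d, (0 < d < d0)%R -> good_cover theta s F eps d]].

Definition lower_interm_dim theta F : \bar R :=
  if theta == 1%R then lower_box_dim F else
  ereal_inf [set s%:E | s in [set s : R | (0 <= s)%R /\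
    forall eps d0 : R, (0 < eps)%R -> (0 < d0 <= 1)%R ->
      exists2 d, (0 < d < d0)%R & good_cover theta s F eps d]].

Definition assouad_dim F : \bar R :=
  ereal_inf [set a%:E | a in [set a : R |
    exists2 C : R, (0 < C)%R & forall x r1 r2, F x -> (0 < r1 < r2)%R ->
      covnum r1 (ball x r2 `&` F) <= (C * (r2 / r1) `^ a)%:E]].

End Dimensions.

Definition uniformly_perfect {R : realType} (X : metricType R) : Prop :=
  exists2 c : R, (0 < c < 1)%R &
    forall (x : X) (r : R), (0 < r)%R -> r%:E < diam [set: X] ->
      ball x r `\` ball x (c * r)%R !=set0.

(* Main.v *)
(* A cover of F by sets of diameter at most d, each meeting F, needs at least
   N_{4d}(F) members: replace each by a ball of radius 2d centred at one of its
   points in F. If the diameters are also at least d^(1/theta), the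
   s-sum of the cover is at least N_{4d}(F) d^(s/theta). At scales where
   N_{4d}(F) > (4d)^(-t) and for s <= theta t, this exceeds 4^(-t), so every
   admissible exponent is larger than theta t. *)
Require Import Defs.
From HB Require Import structures.
From mathcomp Require Import all_boot all_order all_algebra.
From mathcomp Require Import all_classical all_reals all_analysis.
From mathcomp Require Import finmap lra.

Set Implicit Arguments.
Unset Strict Implicit.
Unset Printing Implicit Defensive.

Import Order.TTheory GRing.Theory Num.Theory.
Import numFieldNormedType.Exports.

Local Open Scope classical_set_scope.
Local Open Scope ring_scope.
Local Open Scope ereal_scope.

(** Each finite part of [A] with k elements contributes at least [k * c] to the sum, so
    [k <= e / c]; an infinite [A] would contain finite parts exceeding this bound. *)
Lemma esum_lb_finite (R : realType) (T : choiceType) (A S : set T)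
    (a : T -> \bar R) (c e : R) :
  (0 < c)%R -> A `<=` S -> (forall i, A i -> c%:E <= a i) ->
  \esum_(i in S) a i <= e%:E ->
  exists2 B : {fset T}, A = [set` B] & ((size B)%:R * c <= e)%R.
Proof.
move=> c0 AS ca ae.
have bound (B : {fset T}) : [set` B] `<=` A -> ((size B)%:R * c <= e)%R.
  move=> BA; rewrite -lee_fin; apply: le_trans ae; apply: esum_ge.
  exists [set` B]; first by split; [exact: finite_fset|exact: subset_trans AS].
  rewrite -fsbig_seq ?fset_uniq//.
  apply: (@le_trans _ _ (\sum_(i <- B) c%:E)).
    by rewrite sumEFin big_const_seq count_predT iter_addr_0 mulr_natl.
  by rewrite big_seq [leRHS]big_seq; apply: lee_sum => i iB; exact/ca/BA.
have [/finite_fsetP[B AB]|infA] := pselect (finite_set A).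
  by exists B => //; apply: bound; rewrite AB.
have [B BA nB] := infinite_set_fset (Num.bound `|(e / c)%R|) infA.
have := bound B BA; rewrite -ler_pdivlMr// leNgt => /negP[].
apply: (le_lt_trans (ler_norm _)); apply: (lt_le_trans (archi_boundP _)) => //.
by rewrite ler_nat.
Qed.

Lemma mdist_le_diam (R : realType) (X : metricType R) (U : set X) (x y : X) :
  U x -> U y -> (mdist x y)%:E <= diam U.
Proof.
move=> Ux Uy; rewrite /diam le_max; apply/orP; right.
by apply: ereal_sup_ubound; exists x => //; exists y.
Qed.

Lemma good_cover_covnum_le (R : realType) (X : metricType R) (F : set X)
    (theta s eps d : R) :
  F !=set0 -> (0 <= s)%R -> (0 < d)%R -> good_cover theta s F eps d ->
  exists2 n : nat, covnum (4 * d)%R F <= n%:R%:E &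
    (n%:R * (d `^ theta^-1) `^ s <= eps)%R.
Proof.
move=> [x0 Fx0] s0 d0 [D [U [FU Ud Ueps]]].
(* Members that miss [F] offer no centre in [F] and cover none of it. The others are finitely many,
   since each contributes at least [(d ^ (1 / theta)) ^ s] to the sum. *)
pose A := [set i | D i /\ (U i `&` F) !=set0].
have [||||B AB Beps] := @esum_lb_finite R nat A D (fun i => diam (U i) `^ s)
  ((d `^ theta^-1) `^ s)%R eps; rewrite ?powR_gt0//; first by move=> i [].
  move=> i [/Ud/andP[dU Ud'] _].
  have fU : diam (U i) \is a fin_num.
    by rewrite ge0_fin_numE ?(le_lt_trans Ud') ?ltry// le_max lexx.
  rewrite -(fineK fU) poweR_EFin lee_fin.
  by apply: ge0_ler_powR; rewrite ?nnegrE ?powR_ge0 -?lee_fin ?fineK// le_max lexx.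
have /choice[f fP] i : exists x, A i -> U i x /\ F x.
  have [[Di [x Ux]]|nA] := pselect (A i); first by exists x.
  by exists x0 => /nA.
exists (size B) => //.
apply: ereal_inf_lbound; exists [seq f i | i <- B]; last by rewrite size_map.
split.
  move=> _ /= /mapP[i iB ->].
  by have [] : U i (f i) /\ F (f i) by apply: fP; rewrite AB.
move=> x Fx; have [i Di Ux] := FU x Fx.
have Ai : A i by split => //; exists x.
have [Uf Ff] := fP i Ai.
exists (f i) => /=; first by apply/map_f; move: Ai; rewrite AB.
(* The open ball has radius [4 * d / 2 = 2 * d], strictly above the bound [d] on the distance. *)
rewrite ballEmdist /=.
have /andP[_ /(le_trans (mdist_le_diam Uf Ux))] := Ud i Di.
rewrite lee_fin; lra.
Qed.

(** Taking the cover at scale [e / 4] bounds the covering number at scale exactly [e]. With [n] the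
    bound on it, [n > e ^ (- t)] and [n * (e / 4) ^ (s / theta) <= eps]. *)
Lemma good_cover_box_ratio (R : realType) (X : metricType R) (F : set X)
    (theta s eps t e : R) :
  F !=set0 -> (0 < theta)%R -> (0 < t)%R -> (0 <= s <= theta * t)%R -> (0 < e < 1)%R ->
  t%:E < box_ratio F e -> good_cover theta s F eps (e / 4)%R ->
  (4 `^ (- t) < eps)%R.
Proof.
move=> F0 th0 t0 /andP[s0 sth] /andP[e0 e1] te gc.
have e40 : (0 < e / 4)%R by lra.
have [n nF neps] := good_cover_covnum_le F0 s0 e40 gc.
have e4E : (4 * (e / 4) = e)%R by rewrite mulrC divfK.
rewrite e4E in nF.
have ln0 : (0 < - ln e)%R by rewrite oppr_gt0 ln_lt0 ?e0.
have tn : (e `^ (- t) < n%:R)%R.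
  move: te; rewrite /box_ratio lte_pdivlMr//.
  move: nF; case: (covnum e F) => [r| |]//= rn.
  (* For [r <= 0] the logarithm is [-oo], which cannot exceed a real number. *)
  case: ifPn => [_|]; first by rewrite ltNge leNye.
  rewrite -ltNge => r0; rewrite lte_fin mulrN -mulNr -ln_powR.
  rewrite ltr_ln ?posrE ?powR_gt0// => /lt_le_trans; apply.
  by rewrite -lee_fin.
apply: lt_le_trans neps.
rewrite -powRrM.
(* The base is below 1, so the smaller exponent [s / theta] gives the larger power. *)
have h : ((e / 4) `^ t <= (e / 4) `^ (theta^-1 * s))%R.
  have : (theta^-1 * s <= t)%R by rewrite mulrC ler_pdivrMr// mulrC.
  by apply: ger_powR; lra.
apply: (@lt_le_trans _ _ (n%:R * (e / 4) `^ t)%R); last by rewrite ler_wpM2l.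
have -> : (4 `^ (- t) = e `^ (- t) * (e / 4) `^ t :> R)%R.
  by rewrite -[in RHS]e4E powRM ?(ltW e40)// -mulrA !powRN e4E mulVf ?mulr1//
     gt_eqF ?powR_gt0.
by rewrite ltr_pM2r ?powR_gt0.
Qed.

(** The interval from 0 to [r] is a right neighbourhood of 0, so the supremum of [f] over it is at
    least the upper limit. *)
Lemma lt_limf_esup_right0 (R : realType) (f : R -> \bar R) (t : \bar R) (r : R) :
  (0 < r)%R -> t < limf_esup f 0^'+ -> exists2 e, (0 < e < r)%R & t < f e.
Proof.
move=> r0 tf.
have /ereal_sup_gt[_ [e /= er <-] te] : t < ereal_sup (f @` [set e | 0 < e < r]%R).
  apply: lt_le_trans tf _; apply: ereal_inf_lbound => /=.
  exists [set e | 0 < e < r]%R => //.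
  near=> e; rewrite /=; apply/andP; split; near: e.
    exact: nbhs_right_gt.
  exact: nbhs_right_lt.
by exists e.
Unshelve. all: by end_near. Qed.

Lemma lt_limf_einf_right0 (R : realType) (f : R -> \bar R) (t : \bar R) :
  t < limf_einf f 0^'+ ->
  exists2 r : R, (0 < r)%R & forall e, (0 < e < r)%R -> t < f e.
Proof.
rewrite limf_einfE => /ereal_sup_gt[_ [V V0 <-] tV].
have [r /= r0 rV] := V0; exists r => // e /andP[e0 er].
apply: lt_le_trans tV _; apply: ereal_inf_lbound; exists e => //.
by apply: rV => //=; rewrite sub0r normrN gtr0_norm.
Qed.

Lemma exists_fin_gt0_lt (R : realType) (x : \bar R) :
  0 < x -> exists2 t : R, (0 < t)%R & t%:E < x.
Proof.
case: x => [x||]//; last by exists 1%R => //; exact: ltry.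
by rewrite lte_fin => x0; exists (x / 2)%R; rewrite ?lte_fin; lra.
Qed.

Lemma upper_interm_dim_gt0 (R : realType) (X : metricType R) (F : set X)
    (theta : R) :
  F !=set0 -> (0 < theta)%R -> 0 < upper_box_dim F ->
  0 < upper_interm_dim theta F.
Proof.
move=> F0 th0 dim0; rewrite /upper_interm_dim; case: ifP => // _.
have [t t0 tdim] := exists_fin_gt0_lt dim0.
apply: (@lt_le_trans _ _ (theta * t)%:E); first by rewrite lte_fin mulr_gt0.
apply: le_ereal_inf_tmp => _ [s [s0 sP] <-].
rewrite lee_fin leNgt; apply/negP => /ltW sth.
(* Testing admissibility of [s] with this value yields the contradiction [4 ^ (- t) < 4 ^ (- t)].
   Good covers exist at all small scales, so one small [e] with a large box ratio suffices. *)
have eps0 : (0 < 4 `^ (- t) :> R)%R by rewrite powR_gt0.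
have [d0 /andP[d00 d01] good] := sP _ eps0.
have [e /andP[e0 ed0] te] := lt_limf_esup_right0 d00 tdim.
have := @good_cover_box_ratio R X F theta s (4 `^ (- t))%R t e F0 th0 t0.
rewrite s0 sth e0 (lt_le_trans ed0 d01) ltxx => /(_ isT isT te) contra.
by suff : false by []; apply: contra; apply: good; lra.
Qed.

Lemma lower_interm_dim_gt0 (R : realType) (X : metricType R) (F : set X)
    (theta : R) :
  F !=set0 -> (0 < theta)%R -> 0 < lower_box_dim F ->
  0 < lower_interm_dim theta F.
Proof.
move=> F0 th0 dim0; rewrite /lower_interm_dim; case: ifP => // _.
have [t t0 tdim] := exists_fin_gt0_lt dim0.
apply: (@lt_le_trans _ _ (theta * t)%:E); first by rewrite lte_fin mulr_gt0.
apply: le_ereal_inf_tmp => _ [s [s0 sP] <-].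
rewrite lee_fin leNgt; apply/negP => /ltW sth.
have eps0 : (0 < 4 `^ (- t) :> R)%R by rewrite powR_gt0.
have [r r0 tr] := lt_limf_einf_right0 tdim.
(* Here the ratio is large at all scales below [r], and the cover exists at some scale [d]. Choosing
   [d] below a quarter of this minimum puts [e = 4 * d] below both 1 and [r]. *)
have m0 : (0 < Num.min 1 r :> R)%R by rewrite lt_min ltr01.
have m1 : (Num.min 1 r <= 1 :> R)%R by rewrite ge_min lexx.
have mr : (Num.min 1 r <= r)%R by rewrite ge_min lexx orbT.
have [|d /andP[d0 dm] good] := sP _ (Num.min 1 r / 4)%R eps0; first by lra.
have d4 : (0 < 4 * d < 1)%R by lra.
have d4r : (0 < 4 * d < r)%R by lra.
have sb : (0 <= s <= theta * t)%R by rewrite s0.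
have := @good_cover_box_ratio R X F theta s (4 `^ (- t))%R t (4 * d)%R
  F0 th0 t0 sb d4 (tr _ d4r).
by rewrite ltxx mulrAC divff ?mul1r// => /(_ good).
Qed.

Theorem proposition3p11 (R : realType) (X : metricType R) (F : set X) :
  uniformly_perfect X ->
  (exists x y : X, x <> y) ->
  F !=set0 ->
  totally_bounded F ->
  (0 < upper_box_dim F -> upper_box_dim F <= assouad_dim F ->
   assouad_dim F < +oo ->
   forall theta : R, (0 < theta <= 1)%R -> 0 < upper_interm_dim theta F) /\
  (0 < lower_box_dim F -> lower_box_dim F <= assouad_dim F ->
   assouad_dim F < +oo ->
   forall theta : R, (0 < theta <= 1)%R -> 0 < lower_interm_dim theta F).
Proof.
move=> _ _ F0 _; split=> dim0 _ _ theta /andP[theta0 _].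
- exact: upper_interm_dim_gt0.
- exact: lower_interm_dim_gt0.
Qed.
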